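(* Let $m\ge 2$ and let $A_1,\ldots,A_m\in\mathbb{M}_d$ be positive semidefinite. Define $C_1=A_1$ and, for $2\le j\le m$, $C_j=C_{j-1}\vee A_j$ and $D_j=C_{j-1}\wedge A_j$. Write $C=C_m$ and $S=\sum_{j=1}^m A_j$. Then $$\operatorname{Tr}S-\operatorname{Tr}C=\sum_{j=2}^m\operatorname{Tr}D_j .$$ Moreover, $\operatorname{Tr}C=\operatorname{Tr}S$ if and only if $D_2=\cdots=D_m=0$, or equivalently, if and only if $\operatorname{Ran}A_1+\cdots+\operatorname{Ran}A_m$ is an algebraic direct sum (not necessarily orthogonal).
   Context: $\mathbb{M}_d$ is the algebra of complex $d\times d$ matrices and $\operatorname{Tr}$ is the unnormalized trace. For a Hermitian $X\in\mathbb{M}_d$ and $t\in\mathbb{R}$, $E_X(t)=\mathbf{1}_{(t,\infty)}(X)$ is the orthogonal projection onto the span of the eigenvectors of $X$ with eigenvalue $>t$. The spectral order on Hermitian matrices is: $A\preceq B$ iff $E_A(t)\le E_B(t)$ for all $t\in\mathbb{R}$. With this order the Hermitian matrices in $\mathbb{M}_d$ form a lattice (Olson); $A\vee B$ and $A\wedge B$ denote the supremum (join) and infimum (meet). They are characterized by $E_{A\vee B}(t)=E_A(t)\vee E_B(t)$ and $E_{A\wedge B}(t)=E_A(t)\wedge E_B(t)$ for all $t\in\mathbb{R}$, where for orthogonal projections $P,Q$ the projections $P\vee Q$ and $P\wedge Q$ are the orthogonal projections onto $\operatorname{Ran}P+\operatorname{Ran}Q$ and $\operatorname{Ran}P\cap\operatorname{Ran}Q$,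 respectively. Thus $C_m=\bigvee_{j=1}^m A_j$ is the supremum of the family in the spectral order. The sum of subspaces $V_1+\cdots+V_m$ is an algebraic direct sum if every element of it is uniquely of the form $v_1+\cdots+v_m$ with $v_j\in V_j$. *)

(* Defs.v *)
From mathcomp Require Import all_boot all_order all_algebra.
From mathcomp Require Import classical_sets reals.
From mathcomp Require Export complex.

Set Implicit Arguments.
Unset Strict Implicit.
Unset Printing Implicit Defensive.

Import Order.TTheory GRing.Theory Num.Theory.
Local Open Scope classical_set_scope.
Local Open Scope complex_scope.
Local Open Scope ring_scope.
Local Open Scope sesquilinear_scope.

(* Matrices act on column vectors.  The order on [R[i]] is the partial order
   for which [0 <= z] means that [z] is real and nonnegative. *)

Definition psdmx (R : realType) (d : nat) (X : 'M[R[i]]_d) : Prop :=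
  X \is hermsymmx /\ forall v : 'cV[R[i]]_d, 0 <= (v ^t* *m X *m v) 0 0.

(* The indicator function of (t, +oo) applied to [X] by functional calculus,
   using [X = P^-1 *m diag_mx D *m P] with [P = spectralmx X] unitary and
   [D = spectral_diag X] (real when [X] is Hermitian). The three lemmas below
   show that it is the orthogonal projection onto the span of the eigenvectors
   of [X] with eigenvalue greater than [t], whatever diagonalization is used. *)
Definition spectral_proj (R : realType) (d : nat) (X : 'M[R[i]]_d) (t : R) :
    'M[R[i]]_d :=
  invmx (spectralmx X)
  *m diag_mx (\row_i (t%:C < spectral_diag X 0 i)%R%:R)
  *m spectralmx X.

Lemma spectral_proj_herm (R : realType) (d : nat) (X : 'M[R[i]]_d) (t : R) :
  spectral_proj X t \is hermsymmx.
Proof.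
apply/is_hermitianmxP; rewrite expr0 scale1r /spectral_proj.
rewrite (invmx_unitary (spectral_unitarymx X)).
rewrite !trmx_mul !map_mxM /= trmxCK mulmxA; congr (_ *m _ *m _).
rewrite tr_diag_mx map_diag_mx; congr diag_mx.
by apply/rowP => i; rewrite !mxE rmorph_nat.
Qed.

Lemma spectral_proj_idem (R : realType) (d : nat) (X : 'M[R[i]]_d) (t : R) :
  spectral_proj X t *m spectral_proj X t = spectral_proj X t.
Proof.
rewrite /spectral_proj !mulmxA mulmxK ?spectral_unit //.
rewrite -[_ *m _ *m diag_mx _]mulmxA mulmx_diag; congr (_ *m diag_mx _ *m _).
by apply/rowP => i; rewrite !mxE; case: (_ < _)%R; rewrite ?mulr1 ?mulr0.
Qed.

Lemma spectral_proj_eigen (R : realType) (d : nat) (X : 'M[R[i]]_d) (t : R)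
    (a : R[i]) (v : 'cV[R[i]]_d) :
  X \is hermsymmx -> X *m v = a *: v ->
  spectral_proj X t *m v = if (t%:C < a)%R then v else 0.
Proof.
move=> Xh; rewrite {1}(orthomx_spectralP (hermitian_normalmx Xh)) => Xv.
set w := spectralmx X *m v.
have Dw : diag_mx (spectral_diag X) *m w = a *: w.
  by rewrite /w scalemxAr -Xv !mulmxA mulmxV ?spectral_unit // mul1mx.
have Ew : diag_mx (\row_i (t%:C < spectral_diag X 0 i)%R%:R) *m w
          = (t%:C < a)%R%:R *: w.
  move: w Dw => w Dw; apply/colP => i; move/colP/(_ i): Dw.
  rewrite !mul_diag_mx !mxE; case: (eqVneq (w i 0) 0) => [->|wi0].
    by rewrite !mulr0.
  by move/(mulIf wi0) => ->.
rewrite /spectral_proj -!mulmxA -/w Ew -scalemxAr mulKmx ?spectral_unit //.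
by case: ifP; rewrite ?scale1r ?scale0r.
Qed.

(* Olson's spectral order; projections are compared by the usual order
   [P <= Q] iff [Q - P] is positive semidefinite. *)
Definition spectral_le (R : realType) (d : nat) (A B : 'M[R[i]]_d) : Prop :=
  forall t : R, psdmx (spectral_proj B t - spectral_proj A t).

Definition is_spectral_join (R : realType) (d : nat) (A B C : 'M[R[i]]_d) :
    Prop :=
  [/\ C \is hermsymmx, spectral_le A C, spectral_le B C &
      forall X : 'M[R[i]]_d, X \is hermsymmx ->
        spectral_le A X -> spectral_le B X -> spectral_le C X].

Definition is_spectral_meet (R : realType) (d : nat) (A B C : 'M[R[i]]_d) :
    Prop :=
  [/\ C \is hermsymmx, spectral_le C A, spectral_le C B &
      forall X : 'M[R[i]]_d, X \is hermsymmx ->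
        spectral_le X A -> spectral_le X B -> spectral_le X C].

(* The supremum and infimum of two Hermitian matrices exist and are unique,
   so the default value [0] is irrelevant for Hermitian [A] and [B]. *)
Definition spectral_join (R : realType) (d : nat) (A B : 'M[R[i]]_d) :
    'M[R[i]]_d := xget 0 [set C | is_spectral_join A B C].

Definition spectral_meet (R : realType) (d : nat) (A B : 'M[R[i]]_d) :
    'M[R[i]]_d := xget 0 [set C | is_spectral_meet A B C].

Definition mxran (R : realType) (d : nat) (A : 'M[R[i]]_d) :
    set 'cV[R[i]]_d := range (fun v : 'cV[R[i]]_d => A *m v).

Definition algebraic_direct_sum (W : zmodType) (m : nat) (V : 'I_m -> set W) :
    Prop :=
  forall u v : 'I_m -> W,
    (forall j, V j (u j)) -> (forall j, V j (v j)) ->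
    \sum_j u j = \sum_j v j -> u =1 v.

(* Main.v *)
Require Import Defs.
From mathcomp Require Import all_boot all_order all_algebra.
From mathcomp Require Import classical_sets reals zify ring.

Set Implicit Arguments.
Unset Strict Implicit.
Unset Printing Implicit Defensive.

Import Order.TTheory GRing.Theory Num.Theory.
Local Open Scope ring_scope.
Local Open Scope sesquilinear_scope.

(** Both sides of the trace formula are made of ranks of spectral projections.
    If the eigenvalues of a Hermitian matrix X lie in a grid of reals
    s_0 < ... < s_N, then (layer cake)
      X = s_0 I + sum_k (s_(k+1) - s_k) E_X(s_k),
    so Tr X is s_0 n plus a combination of the ranks of the E_X(s_k) whose
    coefficients depend on the grid only.  Conversely, every decreasing step
    family of orthogonal projections with jumps in the grid is the family of
    spectral projections of its layer sum ([eproj_layer]).  Hence joins and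
    meets in the spectral order exist and are computed threshold by threshold:
    E of the join is the projection onto the sum, E of the meet the projection
    onto the intersection ([is_join_eproj], [is_meet_eproj]).  On one common
    grid, dim (U + V) + dim (U cap V) = dim U + dim V then gives
      Tr (X join Y) + Tr (X meet Y) = Tr X + Tr Y   ([mxtrace_join_meet]),
    and the trace formula is the telescoping sum of these identities.

    A Hermitian X is positive semidefinite iff E_X(t) = I for all t < 0, and
    then its range is that of E_X(0).  Thus joins and meets of positive
    semidefinite matrices are positive semidefinite, with range the sum and the
    intersection of the ranges ([psd_join], [psd_meet]).  In particular the
    Tr D_j are nonnegative and vanish only if D_j = 0, which settles the first
    equivalence; and D_j = 0 means that Ran A_j meets
    Ran A_1 + ... + Ran A_(j-1) trivially, which for all j is the directness of
    the sum ([row_independentP]).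

    The argument is carried out over an arbitrary [C : numClosedFieldType], with
    thresholds the elements of [C] that are real; subspaces are row spaces.  A
    Hermitian matrix has conjugate row and column spaces, so that the ranges of
    the statement are recovered by the adjoint ([range_mulmx]). *)

(** * Orthogonal projections *)

Section Generic.
Variables (C : numClosedFieldType) (n : nat).
Implicit Types (X Y P Q : 'M[C]_n) (t : C) (s : seq C).

Lemma hermsymmxP X : reflect (X^t* = X) (X \is hermsymmx).
Proof.
by apply: (iffP (is_hermitianmxP _ _ _)); rewrite expr0 scale1r => /esym.
Qed.

Lemma adjmxM m1 m2 m3 (X : 'M[C]_(m1, m2)) (Y : 'M[C]_(m2, m3)) :
  (X *m Y)^t* = Y^t* *m X^t*.
Proof. by rewrite trmx_mul map_mxM. Qed.

Definition oprojmx P := P^t* = P /\ P *m P = P.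

(** This is [psdmx] over an arbitrary [C]. *)
Definition psd X :=
  X \is hermsymmx /\ forall v : 'cV[C]_n, 0 <= (v ^t* *m X *m v) 0 0.

Lemma sqnorm_ge0 (v : 'cV[C]_n) : 0 <= (v^t* *m v) 0 0.
Proof. by rewrite mxE sumr_ge0 // => i _; rewrite !mxE mulrC mul_conjC_ge0. Qed.

Lemma sqnorm_eq0 (v : 'cV[C]_n) : (v^t* *m v) 0 0 = 0 -> v = 0.
Proof.
rewrite mxE => /psumr_eq0P v0; apply/colP => i; rewrite mxE; apply/eqP.
rewrite -mul_conjC_eq0 mulrC; have := v0 _ i isT; rewrite !mxE => -> // j _.
by rewrite !mxE mulrC mul_conjC_ge0.
Qed.

Lemma oprojmx1 : oprojmx 1%:M.
Proof. by split; rewrite ?mulmx1 // tr_scalar_mx map_scalar_mx rmorph1. Qed.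

Lemma oprojmx_sub P Q : oprojmx P -> oprojmx Q ->
  (P <= Q)%MS <-> P *m Q = P.
Proof.
move=> _ [_ QQ]; split=> [/submxP[D ->]|<-]; last exact: submxMl.
by rewrite -mulmxA QQ.
Qed.

Lemma oprojmx_subC P Q : oprojmx P -> oprojmx Q ->
  (P <= Q)%MS <-> Q *m P = P.
Proof.
move=> oP oQ; apply: (iff_trans (oprojmx_sub oP oQ)).
case: oP oQ => PE _ [QE _].
by split=> PQ; move: (congr1 (fun Z => Z^t*) PQ); rewrite adjmxM PE QE.
Qed.

Lemma oprojmx_inj P Q : oprojmx P -> oprojmx Q -> (P :=: Q)%MS -> P = Q.
Proof.
move=> oP oQ PQ; have /oprojmx_sub <- // : (P <= Q)%MS by rewrite PQ.
by apply/oprojmx_subC; rewrite // PQ.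
Qed.

Lemma oprojmx_psd P : oprojmx P -> psd P.
Proof.
move=> [PE PP]; split=> [|v]; first exact/hermsymmxP.
by rewrite -PP -{1}PE mulmxA -adjmxM -mulmxA sqnorm_ge0.
Qed.

Lemma col0_inj m1 m2 (X : 'M[C]_(m1, m2)) : (forall j, col j X = 0) -> X = 0.
Proof.
by move=> X0; apply/matrixP => i j; have /colP/(_ i) := X0 j; rewrite !mxE.
Qed.

(** If [Q - P] is positive semidefinite, then [P] kills the kernel of [Q], because
    there - |P v|^2 is nonnegative; applied to the columns of [1 - Q], this gives
    [P *m Q = P].  Conversely [Q - P] is again an orthogonal projection. *)
Lemma oprojmx_psdB P Q : oprojmx P -> oprojmx Q -> psd (Q - P) <-> (P <= Q)%MS.
Proof.
move=> oP oQ; split=> [[_ PQ]|PQ].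
  apply/oprojmx_sub=> //; case: oP oQ => PE PP [QE QQ].
  apply/eqP; rewrite eq_sym -subr_eq0; apply/eqP/col0_inj => i.
  rewrite -{1}[P]mulmx1 -mulmxBr colE -mulmxA; set v := _ *m delta_mx _ _.
  have Qv : Q *m v = 0 by rewrite /v mulmxA mulmxBr mulmx1 QQ subrr mul0mx.
  apply: sqnorm_eq0; apply/eqP; rewrite eq_le sqnorm_ge0 andbT -oppr_ge0.
  have := PQ v; rewrite -mulmxA mulmxBl Qv sub0r mulmxN mxE.
  by rewrite (adjmxM P) PE !mulmxA -[_ *m P *m P]mulmxA PP.
apply: oprojmx_psd; have QP := (oprojmx_subC oP oQ).1 PQ.
have PQ' := (oprojmx_sub oP oQ).1 PQ; case: oP oQ => PE PP [QE QQ].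
split; first by rewrite linearB /= map_mxB PE QE.
by rewrite mulmxBl !mulmxBr QQ PP QP PQ' subrr subr0.
Qed.

(** Self-adjointness: the rows of [1 - P] are orthogonal to those of [P], so
    [P^t* = P *m P^t*], and the right-hand side is self-adjoint. *)
Lemma proj_ortho_oprojmx m (U : 'M[C]_(m, n)) : oprojmx (proj_ortho U).
Proof.
split; last exact: proj_ortho_proj.
set P := proj_ortho U.
have : (1%:M - P) *m P^t* = 0.
  apply/orthomx1P; rewrite -{1}[P]mul1mx.
  apply: submx_trans (proj_ortho_compl_sub _ _) _.
  by rewrite submx_ortho proj_orthoE.
move/eqP; rewrite mulmxBl mul1mx subr_eq0 => /eqP PE.
have : (P *m P^t*)^t* = P *m P^t* by rewrite adjmxM trmxCK.
by rewrite -PE trmxCK => {2}->.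
Qed.

(** In a full rank factorization [P = c *m r], idempotence amounts to
    [r *m c = 1], an identity matrix of size the rank of [P]. *)
Lemma mxtrace_idem P : P *m P = P -> \tr P = (\rank P)%:R.
Proof.
rewrite -{1 2 3}(mulmx_base P) => PP.
have : row_base P *m col_base P = 1%:M.
  apply: (row_free_inj (row_base_free P)); rewrite mul1mx.
  apply: (row_full_inj (col_base_full P)).
  by move: PP; rewrite !mulmxA.
by move=> rc; rewrite -{1}(mulmx_base P) mxtrace_mulC rc mxtrace1.
Qed.

(** * Functional calculus and spectral projections *)

(** The vector [f] lists the values to be put in place of the eigenvalues of [X],
    in the order of [spectral_diag X]. *)
Definition fcalc X (f : 'rV[C]_n) : 'M[C]_n :=
  invmx (spectralmx X) *m diag_mx f *m spectralmx X.

Lemma fcalcM X f g : fcalc X f *m fcalc X g = fcalc X (\row_i (f 0 i * g 0 i)).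
Proof.
rewrite /fcalc !mulmxA mulmxK ?spectral_unit //.
by rewrite -(mulmxA _ (diag_mx f)) mulmx_diag.
Qed.

Lemma fcalc_adj X f : (fcalc X f)^t* = fcalc X (map_mx Num.conj f).
Proof.
rewrite /fcalc (invmx_unitary (spectral_unitarymx X)) !adjmxM trmxCK mulmxA.
by rewrite tr_diag_mx map_diag_mx.
Qed.

Lemma fcalcD X f g : fcalc X f + fcalc X g = fcalc X (f + g).
Proof. by rewrite /fcalc linearD mulmxDr mulmxDl. Qed.

Lemma fcalcZ X a f : a *: fcalc X f = fcalc X (a *: f).
Proof. by rewrite /fcalc linearZ -scalemxAr -scalemxAl. Qed.

Lemma fcalc0 X : fcalc X 0 = 0.
Proof. by rewrite /fcalc linear0 mulmx0 mul0mx. Qed.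

Lemma fcalc_const X a : fcalc X (const_mx a) = a%:M.
Proof.
rewrite /fcalc diag_const_mx mul_mx_scalar -scalemxAl mulVmx ?spectral_unit //.
by rewrite scalemx1.
Qed.

Lemma fcalc_sum X (I : Type) (r : seq I) (f : I -> 'rV_n) :
  \sum_(i <- r) fcalc X (f i) = fcalc X (\sum_(i <- r) f i).
Proof.
elim/big_rec2: _ => [|i y1 y2 _ ->]; first by rewrite fcalc0.
by rewrite fcalcD.
Qed.

Lemma fcalc_inj X : injective (fcalc X).
Proof.
move=> f g /(congr1 (fun Z => spectralmx X *m Z *m invmx (spectralmx X))).
rewrite /fcalc !mulmxA !mulmxK ?spectral_unit // mulmxV ?spectral_unit //.
rewrite !mul1mx => /matrixP fg; apply/rowP => i; have := fg i i.
by rewrite !mxE eqxx.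
Qed.

Lemma mxtrace_fcalc X f : \tr (fcalc X f) = \sum_i f 0 i.
Proof.
rewrite /fcalc -mulmxA mxtrace_mulC -mulmxA mulmxV ?spectral_unit //.
by rewrite mulmx1 mxtrace_diag.
Qed.

Lemma fcalc_spectral X : X \is hermsymmx -> fcalc X (spectral_diag X) = X.
Proof.
by move=> Xh; rewrite /fcalc -(orthomx_spectralP (hermitian_normalmx Xh)).
Qed.

(** The comparison with [t] is the partial order of [C]; for real [t] and
    Hermitian [X] it compares real numbers, so that this is the indicator
    function of the half-line above [t] applied to [X]. *)
Definition eproj X t : 'M[C]_n :=
  fcalc X (\row_i (t < spectral_diag X 0 i)%R%:R).

Lemma eproj_oprojmx X t : oprojmx (eproj X t).
Proof.
rewrite /eproj; split; rewrite ?fcalc_adj ?fcalcM; congr fcalc; apply/rowP => i.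
  by rewrite !mxE rmorph_nat.
by rewrite !mxE -natrM mulnb andbb.
Qed.

Lemma spectral_diag_real X i : X \is hermsymmx -> spectral_diag X 0 i \is Num.real.
Proof. by move=> /hermitian_spectral_diag_real /mxOverP. Qed.

(** Spectral projections are determined by any diagonalization, not only by the
    chosen one; this is how those of a layer sum are found. *)
Lemma eproj_eigen X t a p (Y : 'M[C]_(n, p)) :
  X \is hermsymmx -> X *m Y = a *: Y ->
  eproj X t *m Y = if (t < a)%R then Y else 0.
Proof.
move=> Xh; rewrite -{1}(fcalc_spectral Xh) => XY.
set w := spectralmx X *m Y.
have Dw : diag_mx (spectral_diag X) *m w = a *: w.
  by rewrite /w scalemxAr -XY /fcalc !mulmxA mulmxV ?spectral_unit // mul1mx.
have Ew : diag_mx (\row_i (t < spectral_diag X 0 i)%R%:R) *m w = (t < a)%R%:R *: w.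
  move: w Dw => w Dw; apply/matrixP => i j; move/matrixP/(_ i j): Dw.
  rewrite !mul_diag_mx !mxE; case: (eqVneq (w i j) 0) => [->|wi0].
    by rewrite !mulr0.
  by move/(mulIf wi0) => ->.
rewrite /eproj /fcalc -!mulmxA -/w Ew -scalemxAr mulKmx ?spectral_unit //.
by case: ifP; rewrite ?scale1r ?scale0r.
Qed.

(** * Step families of projections *)

Definition same_position s t t' := all (fun x => (x <= t) == (x <= t')) s.

(** A spectral family whose jumps all lie in [s]. *)
Definition resolution s (F : C -> 'M[C]_n) :=
  [/\ {in Num.real, forall t, oprojmx (F t)},
      {in Num.real &, forall t t', t <= t' -> (F t' <= F t)%MS},
      {in Num.real &, forall t t', same_position s t t' -> F t = F t'},
      {in Num.real, forall t, all (fun x => t < x) s -> F t = 1%:M} &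
      {in Num.real, forall t, all (fun x => x <= t) s -> F t = 0}].

Definition spectrum X := [seq spectral_diag X 0 i | i : 'I_n].

Lemma eproj_resolution X s :
  X \is hermsymmx -> all (fun x => x \is Num.real) s ->
  {subset spectrum X <= s} -> resolution s (eproj X).
Proof.
move=> Xh sreal Xs; have Rx i := spectral_diag_real i Xh.
have Xi i : spectral_diag X 0 i \in s by apply/Xs/map_f; rewrite mem_enum.
split.
- by move=> t _; apply: eproj_oprojmx.
- move=> t t' tR tR' tt'; apply/oprojmx_sub; try exact: eproj_oprojmx.
  rewrite /eproj fcalcM; congr fcalc; apply/rowP => i; rewrite !mxE -natrM mulnb.
  by case: (boolP (t' < _)) => [/(le_lt_trans tt') ->|]; rewrite ?andbF.
- move=> t t' tR tR' /allP st; rewrite /eproj; congr fcalc; apply/rowP => i.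
  have /eqP := st _ (Xi i).
  by rewrite !mxE !real_ltNge // => ->.
- move=> t tR /allP st; rewrite /eproj -(fcalc_const X); congr fcalc.
  by apply/rowP => i; rewrite !mxE st.
- move=> t tR /allP st; rewrite /eproj -(fcalc0 X); congr fcalc.
  by apply/rowP => i; rewrite !mxE real_ltNge // st.
Qed.

(** * The layer cake formula *)

(** The Stieltjes integral of [t] against [- dF], summed by parts, when [F]
    jumps only at the points of [s]. *)
Definition layer s (F : C -> 'M[C]_n) : 'M[C]_n :=
  (s`_0)%:M + \sum_(k < (size s).-1) (s`_k.+1 - s`_k) *: F s`_k.

Definition grid s :=
  [/\ all (fun x => x \is Num.real) s, sorted <%R s & s != [::]].

Lemma telescope_below (V : zmodType) (f : nat -> V) j N : (j <= N)%N ->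
  \sum_(k < N | (k < j)%N) (f k.+1 - f k) = f j - f 0.
Proof.
move=> jN; rewrite -(big_ord_widen N (fun k => f k.+1 - f k) jN).
by rewrite -(big_mkord xpredT (fun k => f k.+1 - f k)) telescope_sumr.
Qed.

Lemma grid_lt s i j : grid s -> (i < size s)%N -> (j < size s)%N ->
  (s`_i < s`_j) = (i < j)%N.
Proof. by move=> [_ sS _] si sj; rewrite lt_sorted_ltn_nth. Qed.

Lemma grid_le s i j : grid s -> (i < size s)%N -> (j < size s)%N ->
  (s`_i <= s`_j) = (i <= j)%N.
Proof. by move=> [_ sS _] si sj; rewrite lt_sorted_leq_nth. Qed.

Lemma grid_real s i : grid s -> s`_i \is Num.real.
Proof.
move=> [/allP sR _ _]; have [si|si] := ltnP i (size s).
  by apply/sR/mem_nth.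
by rewrite nth_default.
Qed.

Lemma grid_size s : grid s -> size s = (size s).-1.+1.
Proof. by case=> _ _; case: s. Qed.

(** The case of a scalar: the increments of the grid below [a] add up to
    [a - s`_0]. *)
Lemma layer_scalar s a : grid s -> a \in s ->
  s`_0 + \sum_(k < (size s).-1) (s`_k.+1 - s`_k) * (s`_k < a)%R%:R = a.
Proof.
move=> sG /(nthP 0) [j js <-]; have sN := grid_size sG.
have jN : (j <= (size s).-1)%N by rewrite -ltnS -sN.
rewrite -[RHS](subrK s`_0) -(telescope_below (fun k => s`_k) jN) addrC.
rewrite [in RHS]big_mkcond; congr (_ + _); apply: eq_bigr => k _.
have ks : (k < size s)%N := leq_trans (ltn_ord k) (leq_pred _).
by rewrite grid_lt //; case: ifP; rewrite ?mulr1 ?mulr0.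
Qed.

Lemma layer_eproj s X : grid s -> X \is hermsymmx ->
  {subset spectrum X <= s} -> layer s (eproj X) = X.
Proof.
move=> sG Xh Xs; rewrite -[RHS](fcalc_spectral Xh) /layer.
rewrite -(fcalc_const X) (eq_bigr _ (fun k _ => fcalcZ X _ _)) fcalc_sum fcalcD.
congr fcalc; apply/rowP => i; rewrite !mxE summxE.
rewrite -[RHS](layer_scalar sG); last by apply/Xs/map_f; rewrite mem_enum.
by congr (_ + _); apply: eq_bigr => k _; rewrite !mxE.
Qed.

(** A resolution is recovered from its layer sum: the jump [Q k] of [F] at the
    k-th grid point is an eigenspace of the layer sum with eigenvalue [s`_k],
    and the jumps add up to the identity. *)
Section ResolutionLayer.
Variables (s : seq C) (F : C -> 'M[C]_n).
Hypotheses (sG : grid s) (Fs : resolution s F).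

(* Left limits of [F] at the grid points: below the grid [F] is the identity. *)
Let G k := if k is k'.+1 then F s`_k' else 1%:M.
Let Q k := G k - G k.+1.

Let FQ t k : t \is Num.real -> (k < size s)%N ->
  F t *m Q k = if t < s`_k then Q k else 0.
Proof.
move=> tR ks; have [Fo Fle Fst F1 F0] := Fs.
have sR i := grid_real i sG.
have FFl u v : u \is Num.real -> v \is Num.real -> u <= v -> F u *m F v = F v.
  move=> uR vR uv; apply/oprojmx_subC; [exact: Fo|exact: Fo|exact: Fle].
have FFr u v : u \is Num.real -> v \is Num.real -> u <= v -> F v *m F u = F v.
  move=> uR vR uv; apply/oprojmx_sub; [exact: Fo|exact: Fo|exact: Fle].
rewrite mulmxBr; case: (real_ltP tR (sR k)) => [tk|kt].
  rewrite (FFl t s`_k) // ?ltW //; congr (_ - _).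
  (* [F t] fixes the left limit at [s`_k]: compare [t] with the point before. *)
  case: k ks tk => [|k] ks tk /=.
    rewrite F1 ?mulmx1 //; apply/allP => x /(nthP 0) [i si <-].
    by apply: lt_le_trans tk _; rewrite grid_le.
  have ks' : (k < size s)%N by exact: ltnW.
  case: (real_leP tR (sR k)) => [tk'|kt']; first exact: FFl.
  have -> : F t = F s`_k; last exact: (Fo _ (sR k)).2.
  apply/esym/Fst => //; apply/allP => x /(nthP 0) [i si <-].
  rewrite grid_le //; case: leqP => ik.
    by rewrite (le_trans _ (ltW kt')) // grid_le.
  by rewrite eq_sym eqbF_neg -real_ltNge // (lt_le_trans tk) // grid_le.
rewrite (FFr s`_k t) //; apply/eqP; rewrite subr_eq0; apply/eqP.
case: k ks kt => [|k] ks kt /=; first by rewrite mulmx1.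
rewrite (FFr s`_k t) // (le_trans _ kt) // grid_le //; exact: ltnW.
Qed.

Let sumQ : \sum_(k < size s) Q k = 1%:M.
Proof.
have Glast : G (size s) = 0.
  rewrite (grid_size sG) /=; have [_ _ _ _ F0] := Fs.
  apply: F0; first exact: grid_real.
  apply/allP => x /(nthP 0) [i si <-]; rewrite grid_le // -ltnS -grid_size //.
have := telescope_sumr (fun k => - G k) (leq0n (size s)).
rewrite Glast oppr0 add0r opprK big_mkord => sumG.
rewrite -[RHS]/(G 0) -sumG.
by apply: eq_bigr => k _; rewrite opprK addrC.
Qed.

Lemma layer_hermsymmx : layer s F \is hermsymmx.
Proof.
apply/hermsymmxP; rewrite /layer linearD /= map_mxD tr_scalar_mx map_scalar_mx /=.
have sR i : Num.conj s`_i = s`_i by apply/CrealP/grid_real.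
rewrite sR linear_sum /= map_mx_sum; congr (_ + _); apply: eq_bigr => k _.
rewrite linearZ /= map_mxZ /= rmorphB /= !sR.
by have [Fo _ _ _ _] := Fs; rewrite (Fo _ _).1 // grid_real.
Qed.

Let layerQ k : (k < size s)%N -> layer s F *m Q k = s`_k *: Q k.
Proof.
move=> ks; rewrite /layer mulmxDl mul_scalar_mx mulmx_suml.
have kN : (k <= (size s).-1)%N by rewrite -ltnS -grid_size.
rewrite -[in RHS](subrK s`_0 s`_k) addrC scalerDl; congr (_ + _).
rewrite -(telescope_below (fun k => s`_k) kN) scaler_suml [in RHS]big_mkcond /=.
apply: eq_bigr => l _; have ls : (l < size s)%N := leq_trans (ltn_ord l) (leq_pred _).
rewrite -scalemxAl FQ ?grid_real // grid_lt //.
by case: ifP; rewrite ?scaler0.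
Qed.

Lemma eproj_layer t : t \is Num.real -> eproj (layer s F) t = F t.
Proof.
move=> tR; rewrite -[LHS]mulmx1 -[RHS]mulmx1 -sumQ !mulmx_sumr.
apply: eq_bigr => k _; rewrite FQ //; apply: eproj_eigen; first exact: layer_hermsymmx.
exact: layerQ.
Qed.
End ResolutionLayer.

(** * The spectral order *)

Definition sle X Y := {in Num.real, forall t, psd (eproj Y t - eproj X t)}.

Lemma sleP X Y : sle X Y <-> {in Num.real, forall t, (eproj X t <= eproj Y t)%MS}.
Proof.
by split=> XY t /XY; move/(oprojmx_psdB (eproj_oprojmx X t) (eproj_oprojmx Y t)).
Qed.

(** The point 0 is thrown in to make the grid nonempty when there is no
    eigenvalue. *)
Lemma exists_grid (l : seq 'M[C]_n) : {in l, forall X, X \is hermsymmx} ->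
  exists2 s, grid s & {in l, forall X, {subset spectrum X <= s}}.
Proof.
move=> lh; pose r := undup (0 :: flatten [seq spectrum X | X <- l]).
have rP x : x \in r -> x \is Num.real.
  rewrite mem_undup inE => /predU1P [->|]; first exact: real0.
  case/flattenP => _ /mapP [X /lh Xh ->] /mapP [i _ ->].
  exact: spectral_diag_real.
exists (sort <=%R r).
  split; first by apply/allP => x; rewrite mem_sort => /rP.
    rewrite lt_sorted_uniq_le sort_uniq undup_uniq /=.
    apply: (@sort_sorted_in _ Num.real) => [x y|]; first exact: real_leVge.
    exact/allP.
  have : 0 \in sort <=%R r by rewrite mem_sort mem_undup mem_head.
  by case: (sort _ _).
move=> X Xl x xX; rewrite mem_sort mem_undup inE; apply/orP; right.
by apply/flattenP; exists (spectrum X) => //; apply: map_f.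
Qed.

Lemma eproj_inj X Y : X \is hermsymmx -> Y \is hermsymmx ->
  {in Num.real, eproj X =1 eproj Y} -> X = Y.
Proof.
move=> Xh Yh XY; have [|s sG sXY] := @exists_grid [:: X; Y].
  by move=> Z; rewrite !inE => /orP [] /eqP ->.
rewrite -(layer_eproj sG Xh); last by apply: sXY; rewrite !inE eqxx.
rewrite -(layer_eproj sG Yh); last by apply: sXY; rewrite !inE eqxx orbT.
by congr (_ + _); apply: eq_bigr => k _; rewrite XY // grid_real.
Qed.

Lemma sle_anti X Y : X \is hermsymmx -> Y \is hermsymmx ->
  sle X Y -> sle Y X -> X = Y.
Proof.
move=> Xh Yh /sleP XY /sleP YX; apply: eproj_inj => // t tR.
apply: oprojmx_inj; try exact: eproj_oprojmx.
by apply/eqmxP; rewrite XY // YX.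
Qed.

(** Joins and meets at once, taking for [op] the sum or the intersection of
    subspaces.  On a common grid the projections onto the pointwise [op] form
    a resolution, and [Z] is its layer sum. *)
Lemma exists_eproj_op (op : 'M[C]_n -> 'M[C]_n -> 'M[C]_n) X Y :
  (forall P P' Q Q', (P <= P')%MS -> (Q <= Q')%MS -> (op P Q <= op P' Q')%MS) ->
  (op 1%:M 1%:M :=: (1%:M : 'M_n))%MS -> (op 0 0 :=: (0 : 'M_n))%MS ->
  X \is hermsymmx -> Y \is hermsymmx ->
  exists2 Z, Z \is hermsymmx &
    {in Num.real, forall t, (eproj Z t :=: op (eproj X t) (eproj Y t))%MS}.
Proof.
move=> opS op1 op0 Xh Yh; have [|s sG sXY] := @exists_grid [:: X; Y].
  by move=> Z; rewrite !inE => /orP [] /eqP ->.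
pose F t := proj_ortho (op (eproj X t) (eproj Y t)).
have [sR _ _] := sG.
have [oX leX stX X1 X0] : resolution s (eproj X).
  by apply: eproj_resolution => //; apply: sXY; rewrite !inE eqxx.
have [oY leY stY Y1 Y0] : resolution s (eproj Y).
  by apply: eproj_resolution => //; apply: sXY; rewrite !inE eqxx orbT.
have rF : resolution s F.
  split.
  - by move=> t tR; apply: proj_ortho_oprojmx.
  - move=> t t' tR t'R tt'; rewrite !proj_orthoE.
    by apply: opS; [exact: leX|exact: leY].
  - by move=> t t' tR t'R tt'; rewrite /F (stX t t' tR t'R tt') (stY t t' tR t'R tt').
  - move=> t tR ts; rewrite /F X1 // Y1 //.
    apply: oprojmx_inj (proj_ortho_oprojmx _) oprojmx1 _.
    by apply: eqmx_trans op1; apply: proj_orthoE.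
  - move=> t tR ts; rewrite /F X0 // Y0 //; apply/eqP.
    by rewrite -submx0 proj_orthoE op0.
exists (layer s F); first exact: layer_hermsymmx.
by move=> t tR; rewrite eproj_layer //; apply: proj_orthoE.
Qed.

(** * Joins and meets *)

Definition is_join X Y Z := [/\ Z \is hermsymmx, sle X Z, sle Y Z &
  forall W, W \is hermsymmx -> sle X W -> sle Y W -> sle Z W].

Definition is_meet X Y Z := [/\ Z \is hermsymmx, sle Z X, sle Z Y &
  forall W, W \is hermsymmx -> sle W X -> sle W Y -> sle W Z].

Lemma eproj_is_join X Y Z : Z \is hermsymmx ->
  {in Num.real, forall t, (eproj Z t :=: eproj X t + eproj Y t)%MS} -> is_join X Y Z.
Proof.
move=> Zh ZE; split=> [|||W Wh /sleP XW /sleP YW]; first exact: Zh.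
all: apply/sleP => t tR.
- by rewrite ZE // addsmxSl.
- by rewrite ZE // addsmxSr.
- by rewrite ZE // addsmx_sub XW // YW.
Qed.

Lemma eproj_is_meet X Y Z : Z \is hermsymmx ->
  {in Num.real, forall t, (eproj Z t :=: eproj X t :&: eproj Y t)%MS} -> is_meet X Y Z.
Proof.
move=> Zh ZE; split=> [|||W Wh /sleP XW /sleP YW]; first exact: Zh.
all: apply/sleP => t tR.
- by rewrite ZE // capmxSl.
- by rewrite ZE // capmxSr.
- by rewrite ZE // sub_capmx XW // YW.
Qed.

Lemma exists_join X Y : X \is hermsymmx -> Y \is hermsymmx ->
  exists2 Z, is_join X Y Z &
    {in Num.real, forall t, (eproj Z t :=: eproj X t + eproj Y t)%MS}.
Proof.
move=> Xh Yh; have [|||Z Zh ZE] := @exists_eproj_op (@addsmx C n n n) X Y _ _ _ Xh Yh.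
- by move=> *; apply: addsmxS.
- by apply/eqmxP; rewrite submx1 addsmxSl.
- by apply/eqmxP; rewrite addsmx_sub !sub0mx.
exists Z; last exact: ZE.
exact: eproj_is_join.
Qed.

Lemma exists_meet X Y : X \is hermsymmx -> Y \is hermsymmx ->
  exists2 Z, is_meet X Y Z &
    {in Num.real, forall t, (eproj Z t :=: eproj X t :&: eproj Y t)%MS}.
Proof.
move=> Xh Yh; have [|||Z Zh ZE] := @exists_eproj_op (@capmx C n n n) X Y _ _ _ Xh Yh.
- by move=> *; apply: capmxS.
- by apply/eqmxP; rewrite submx1 sub_capmx !submx1.
- by apply/eqmxP; rewrite capmxSl sub0mx.
exists Z; last exact: ZE.
exact: eproj_is_meet.
Qed.

(** The order determines its suprema, so the one built from the sums of the
    spectral subspaces is the only one. *)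
Lemma is_join_eproj X Y Z : X \is hermsymmx -> Y \is hermsymmx -> is_join X Y Z ->
  {in Num.real, forall t, (eproj Z t :=: eproj X t + eproj Y t)%MS}.
Proof.
move=> Xh Yh [Zh XZ YZ Zm]; have [J [Jh XJ YJ Jm] JE] := exists_join Xh Yh.
have <- : J = Z by apply: sle_anti; [exact: Jh|exact: Zh|exact: Jm|exact: Zm].
exact: JE.
Qed.

Lemma is_meet_eproj X Y Z : X \is hermsymmx -> Y \is hermsymmx -> is_meet X Y Z ->
  {in Num.real, forall t, (eproj Z t :=: eproj X t :&: eproj Y t)%MS}.
Proof.
move=> Xh Yh [Zh XZ YZ Zm]; have [J [Jh XJ YJ Jm] JE] := exists_meet Xh Yh.
have <- : J = Z by apply: sle_anti; [exact: Jh|exact: Zh|exact: Zm|exact: Jm].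
exact: JE.
Qed.

Lemma mxtrace_layer s F : \tr (layer s F) =
  s`_0 *+ n + \sum_(k < (size s).-1) (s`_k.+1 - s`_k) * \tr (F s`_k).
Proof.
rewrite /layer mxtraceD mxtrace_scalar linear_sum /=; congr (_ + _).
by apply: eq_bigr => k _; rewrite mxtraceZ.
Qed.

(** On a grid common to the four matrices, this is the modular law for the
    dimensions of the spectral subspaces at each grid point. *)
Theorem mxtrace_join_meet X Y J M : X \is hermsymmx -> Y \is hermsymmx ->
  is_join X Y J -> is_meet X Y M -> \tr J + \tr M = \tr X + \tr Y.
Proof.
move=> Xh Yh jJ mM; have [Jh _ _ _] := jJ; have [Mh _ _ _] := mM.
have JE := is_join_eproj Xh Yh jJ; have ME := is_meet_eproj Xh Yh mM.
have [|s sG sub] := @exists_grid [:: X; Y; J; M].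
  by move=> Z; rewrite !inE => /or4P [] /eqP ->.
have trE Z : Z \in [:: X; Y; J; M] -> Z \is hermsymmx -> \tr Z =
    s`_0 *+ n + \sum_(k < (size s).-1) (s`_k.+1 - s`_k) * (\rank (eproj Z s`_k))%:R.
  move=> Zl Zh; rewrite -[in LHS](layer_eproj sG Zh (sub _ Zl)) mxtrace_layer.
  congr (_ + _); apply: eq_bigr => k _; rewrite mxtrace_idem //.
  by have [] := eproj_oprojmx Z s`_k.
rewrite !trE ?inE ?eqxx ?orbT // addrACA [RHS]addrACA -!big_split /=.
congr (_ + _); apply: eq_bigr => k _; rewrite -!mulrDr -!natrD; congr (_ * _%:R).
have kR := grid_real k sG.
by rewrite (JE _ kR) (ME _ kR) mxrank_sum_cap.
Qed.

(** * Positive semidefinite matrices *)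

Lemma psd_spectral_diag X i : psd X -> 0 <= spectral_diag X 0 i.
Proof.
move=> [Xh Xp]; set P := spectralmx X.
have Pu : P^t* = invmx P by rewrite invmx_unitary // spectral_unitarymx.
have := Xp (P^t* *m delta_mx i 0).
have XE : X = invmx P *m diag_mx (spectral_diag X) *m P.
  by rewrite -[LHS](fcalc_spectral Xh).
rewrite adjmxM trmxCK {1}XE Pu !mulmxA.
rewrite mulmxK ?spectral_unit // mulmxK ?spectral_unit //.
have -> : (delta_mx i 0 : 'cV[C]_n)^t* = delta_mx 0 i.
  by apply/matrixP => a b; rewrite !mxE rmorph_nat andbC.
by rewrite -rowE -colE !mxE eqxx mulr1n.
Qed.

Lemma spectral_diag_psd X : X \is hermsymmx ->
  (forall i, 0 <= spectral_diag X 0 i) -> psd X.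
Proof.
move=> Xh Xp; split=> // v; rewrite -{1}(fcalc_spectral Xh) /fcalc.
rewrite invmx_unitary ?spectral_unitarymx // !mulmxA -adjmxM -mulmxA.
move: (_ *m v) => w; rewrite -mulmxA mul_diag_mx mxE sumr_ge0 // => i _.
by rewrite !mxE mulrCA mulr_ge0 // mulrC mul_conjC_ge0.
Qed.

(** Positivity read off the spectral family, which is the form in which it passes
    to joins and meets.  The converse tests the threshold at a negative
    eigenvalue, which the projection does not reach. *)
Lemma psdE X : psd X <-> X \is hermsymmx /\
  {in Num.real, forall t, t < 0 -> (eproj X t :=: (1%:M : 'M_n))%MS}.
Proof.
split=> [Xp|[Xh X1]].
  have [Xh _] := Xp; split=> // t tR t0; rewrite /eproj -(fcalc_const X).
  rewrite (_ : \row_i _ = const_mx 1) //; apply/rowP => i.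
  by rewrite !mxE (lt_le_trans t0) // psd_spectral_diag.
apply: spectral_diag_psd => // i; have Ri := spectral_diag_real i Xh.
rewrite real_leNgt ?real0 //; apply/negP => i0.
have : eproj X (spectral_diag X 0 i) = 1%:M.
  by apply: oprojmx_inj (eproj_oprojmx _ _) oprojmx1 _; exact: X1.
rewrite /eproj -(fcalc_const X) => /fcalc_inj/rowP/(_ i).
by rewrite !mxE ltxx => /esym/eqP; rewrite oner_eq0.
Qed.

(** [X = X *m E] and [E = X^+ *m X], with [E] the projection at 0 and [X^+] the
    inverse of [X] on its nonzero eigenvalues ([0^-1 = 0] here). *)
Lemma psd_eqmx X : psd X -> (X :=: eproj X 0)%MS.
Proof.
move=> Xp; have [Xh _] := Xp; have X0 i := psd_spectral_diag i Xp.
apply/eqmxP/andP; split; apply/submxP.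
  exists (fcalc X (spectral_diag X)).
  rewrite /eproj fcalcM -[LHS](fcalc_spectral Xh).
  congr fcalc; apply/rowP => i; rewrite !mxE.
  by have := X0 i; rewrite le0r => /predU1P [->|->]; rewrite ?mul0r ?mulr1.
exists (fcalc X (\row_i (spectral_diag X 0 i)^-1)).
rewrite -[X in _ = _ *m X](fcalc_spectral Xh) /eproj fcalcM.
congr fcalc; apply/rowP => i; rewrite !mxE.
have := X0 i; rewrite le0r.
by case: eqVneq => [->|i0 /= ->]; rewrite ?ltxx ?mulr0 ?mulVf.
Qed.

Lemma psd_mxtrace_ge0 X : psd X -> 0 <= \tr X.
Proof.
move=> Xp; rewrite -(fcalc_spectral Xp.1) mxtrace_fcalc sumr_ge0 // => i _.
exact: psd_spectral_diag.
Qed.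

Lemma psd_mxtrace_eq0 X : psd X -> \tr X = 0 -> X = 0.
Proof.
move=> Xp; rewrite -{1}(fcalc_spectral Xp.1) mxtrace_fcalc => /psumr_eq0P X0.
rewrite -(fcalc_spectral Xp.1) -(fcalc0 X); congr fcalc; apply/rowP => i.
by rewrite mxE X0 // => j _; apply: psd_spectral_diag.
Qed.

Lemma psd_join X Y Z : psd X -> psd Y -> is_join X Y Z ->
  psd Z /\ (Z :=: X + Y)%MS.
Proof.
move=> Xp Yp jZ; have ZE := is_join_eproj Xp.1 Yp.1 jZ.
have Zp : psd Z.
  apply/psdE; split=> [|t tR t0]; first by case: jZ.
  have [_ X1] := (psdE X).1 Xp.
  by apply/eqmxP; rewrite submx1 ZE //= -(X1 t tR t0) addsmxSl.
split=> //; apply: eqmx_trans (psd_eqmx Zp) _.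
apply: eqmx_trans (ZE 0 (real0 _)) _; apply: adds_eqmx; exact/eqmx_sym/psd_eqmx.
Qed.

Lemma psd_meet X Y Z : psd X -> psd Y -> is_meet X Y Z ->
  psd Z /\ (Z :=: X :&: Y)%MS.
Proof.
move=> Xp Yp jZ; have ZE := is_meet_eproj Xp.1 Yp.1 jZ.
have Zp : psd Z.
  apply/psdE; split=> [|t tR t0]; first by case: jZ.
  have [_ X1] := (psdE X).1 Xp; have [_ Y1] := (psdE Y).1 Yp.
  by apply/eqmxP; rewrite submx1 ZE //= sub_capmx (X1 t tR t0) (Y1 t tR t0) submx1.
split=> //; apply: eqmx_trans (psd_eqmx Zp) _.
apply: eqmx_trans (ZE 0 (real0 _)) _; apply: cap_eqmx; exact/eqmx_sym/psd_eqmx.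
Qed.

End Generic.

(** * Direct sums of subspaces *)

(** [S j] stands for [B 0 + ... + B j]; it is a parameter because the iterated
    joins provide these sums only up to equality of row spaces. *)
Section Independence.
Variables (F : fieldType) (n m : nat) (B S : nat -> 'M[F]_n).
Hypothesis S0 : (0 < m)%N -> (S 0 :=: B 0)%MS.
Hypothesis SS : forall j, (j.+1 < m)%N -> (S j.+1 :=: S j + B j.+1)%MS.

Definition row_independent := forall w : nat -> 'rV[F]_n,
  (forall i, (i < m)%N -> (w i <= B i)%MS) -> \sum_(i < m) w i = 0 ->
  forall i, (i < m)%N -> w i = 0.

Let sum_subS (w : nat -> 'rV[F]_n) j : (j < m)%N ->
  (forall i, (i < m)%N -> (w i <= B i)%MS) -> ((\sum_(i < j.+1) w i)%R <= S j)%MS.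
Proof.
elim: j => [|j IH] jm wB; first by rewrite big_ord1 S0 ?wB.
rewrite big_ord_recr /= SS // addmx_sub_adds ?wB // IH //; exact: ltnW.
Qed.

Let subS_sum j (x : 'rV[F]_n) : (j < m)%N -> (x <= S j)%MS ->
  exists2 w : nat -> 'rV[F]_n, forall i, (w i <= B i)%MS & \sum_(i < j.+1) w i = x.
Proof.
elim: j x => [|j IH] x jm.
  rewrite S0 // => xB; exists (fun i => if i == 0%N then x else 0).
    by case=> [|i] //=; rewrite sub0mx.
  by rewrite big_ord1.
rewrite SS // => /sub_addsmxP [[u v] /= ->].
have [|w wB wE] := IH (u *m S j) (ltnW jm); first exact: submxMl.
exists (fun i => if i == j.+1 then v *m B j.+1 else w i).
  by move=> i; case: eqP => [->|_]; rewrite ?submxMl.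
rewrite big_ord_recr /= eqxx -wE; congr (_ + _); apply: eq_bigr => i _.
by rewrite ltn_eqF.
Qed.

(** From independence: a vector of [S j :&: B j.+1] is a sum of vectors of the
    earlier subspaces, and moving it to the other side gives a vanishing sum.
    To independence: in a vanishing sum the last term lies in the intersection,
    hence is 0, and can be removed. *)
Lemma row_independentP :
  row_independent <-> forall j, (j.+1 < m)%N -> (S j :&: B j.+1)%MS = 0.
Proof.
split=> [ind j jm|cap0 w wB].
  apply/eqP/rowV0P => x; rewrite sub_capmx => /andP [xS xB].
  have [w wB wE] := subS_sum (ltnW jm) xS.
  (* the relation [\sum_(i <= j) w i - x = 0], extended by 0 up to [m] *)
  pose w' i := if (i <= j)%N then w i else if i == j.+1 then - x else 0.
  have := ind w' _ _ _ jm; rewrite /w' ltnn eqxx => w'0.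
  apply/eqP; rewrite -oppr_eq0; apply/eqP/w'0.
    move=> i _; case: ifP => // _; case: eqP => [->|_]; last exact: sub0mx.
    by rewrite eqmx_opp.
  rewrite (bigID (fun i : 'I_m => (i < j.+2)%N)) /=.
  rewrite -(big_ord_widen _ w') // big_ord_recr /= [X in _ + X]big1 ?addr0.
    suff -> : \sum_(i < j.+1) w' i = x by rewrite /w' ltnn eqxx subrr.
    by rewrite -wE; apply: eq_bigr => i _; rewrite /w' -ltnS ltn_ord.
  by move=> i; rewrite -leqNgt => ji; rewrite /w' leqNgt (ltnW ji) gtn_eqF.
suff H k : (k <= m)%N -> \sum_(i < k) w i = 0 -> forall i, (i < k)%N -> w i = 0.
  exact: H.
elim: k => [|[|k] IH] // km.
  by rewrite big_ord1 => w0 [].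
rewrite big_ord_recr /= => wE.
have wk : w k.+1 = 0.
  apply/eqP; rewrite -submx0 -(cap0 k km) sub_capmx wB // andbT.
  move/eqP: wE; rewrite addrC addr_eq0 => /eqP ->.
  by rewrite eqmx_opp sum_subS // ltnW.
move=> i; rewrite ltnS leq_eqVlt => /predU1P [->|] //; apply: IH; first exact: ltnW.
by rewrite wk addr0 in wE.
Qed.
End Independence.

Section Range.
Variables (C : numClosedFieldType) (n : nat).

Lemma range_mulmx (X : 'M[C]_n) (u : 'cV[C]_n) : X \is hermsymmx ->
  range (fun v : 'cV[C]_n => X *m v) u <-> (u^t* <= X)%MS.
Proof.
move=> /hermsymmxP XE; split=> [[v _ <-]|/submxP [D uE]].
  by rewrite adjmxM XE submxMl.
by exists (D^t*) => //; rewrite -[RHS]trmxCK uE adjmxM XE.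
Qed.

Lemma algebraic_direct_sumP m (B : nat -> 'M[C]_n) :
  (forall j, (j < m)%N -> B j \is hermsymmx) ->
  algebraic_direct_sum (fun j : 'I_m => range (fun v : 'cV[C]_n => B j *m v)) <->
  row_independent m B.
Proof.
move=> Bh; split=> [ds w wB w0 i im|ind u v uB vB uv].
  have adj0 p q : (0 : 'M[C]_(p, q))^t* = 0 by rewrite trmx0 map_mx0.
  have := ds (fun j => (w j)^t*) (fun=> 0) _ _ _ (Ordinal im) => /= /(_ _ _ _) w0i.
  rewrite -[LHS]trmxCK w0i ?adj0 //.
  - by move=> j; apply/range_mulmx; rewrite ?Bh // trmxCK wB.
  - by move=> j; exists 0; rewrite ?mulmx0.
  - by rewrite -map_mx_sum -linear_sum /= w0 adj0 big1.
pose w i := if insub i is Some j then (u j - v j)^t* else 0.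
have wE (j : 'I_m) : w j = (u j - v j)^t* by rewrite /w valK.
move=> j; apply/eqP; rewrite -subr_eq0 -[_ - _]trmxCK -wE; apply/eqP.
rewrite ind ?trmx0 ?map_mx0 // => [i im|].
  have /= -> := wE (Ordinal im); rewrite linearB /= map_mxB.
  have uBi := (range_mulmx _ (Bh i im)).1 (uB (Ordinal im)).
  have vBi := (range_mulmx _ (Bh i im)).1 (vB (Ordinal im)).
  by rewrite addmx_sub // eqmx_opp.
rewrite (eq_bigr _ (fun i _ => wE i)) -map_mx_sum -linear_sum /=.
by rewrite sumrB uv subrr trmx0 map_mx0.
Qed.
End Range.

(** * Iterated joins *)

Theorem iterated_join (C : numClosedFieldType) (n m : nat) (hm : (0 < m)%N)
    (A J D : nat -> 'M[C]_n)
    (hA : forall j, (1 <= j <= m)%N -> psd (A j))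
    (hJ : forall j, (1 <= j <= m)%N -> psd (J j))
    (hJ1 : J 1%N = A 1%N)
    (hJA : forall j, (2 <= j <= m)%N -> is_join (J j.-1) (A j) (J j))
    (hD : forall j, (2 <= j <= m)%N -> is_meet (J j.-1) (A j) (D j)) :
  let S := \sum_(1 <= j < m.+1) A j in
  [/\ \tr S - \tr (J m) = \sum_(2 <= j < m.+1) \tr (D j),
      \tr (J m) = \tr S <-> (forall j, (2 <= j <= m)%N -> D j = 0)
    & \tr (J m) = \tr S <->
      algebraic_direct_sum
        (fun j : 'I_m => range (fun v : 'cV[C]_n => A j.+1 *m v))].
Proof.
move=> S.
have hS k : (k < m)%N ->
    \sum_(1 <= j < k.+2) \tr (A j) - \tr (J k.+1) = \sum_(2 <= j < k.+2) \tr (D j).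
  elim: k => [|k IH] km; first by rewrite big_nat1 hJ1 subrr big_geq.
  rewrite big_nat_recr // [RHS]big_nat_recr //= -IH; last exact: ltnW.
  have [Jk Ak] : psd (J k.+1) /\ psd (A k.+2).
    by split; [exact: (hJ k.+1 (ltnW km))|exact: (hA k.+2 km)].
  have /(canRL (addrK _)) -> := mxtrace_join_meet Jk.1 Ak.1 (hJA k.+2 km) (hD k.+2 km).
  by ring.
have trS : \tr S - \tr (J m) = \sum_(2 <= j < m.+1) \tr (D j).
  rewrite /S linear_sum /=; case: (m) hm hS => // k _ /(_ k (leqnn _)); exact.
have DP j : (2 <= j <= m)%N -> psd (D j) /\ (D j :=: J j.-1 :&: A j)%MS.
  move=> jm; apply: psd_meet; [apply: hJ|apply: hA|exact: hD]; lia.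
have trD : \tr (J m) = \tr S <-> (forall j, (2 <= j <= m)%N -> D j = 0).
  split=> [JS j jm|D0]; last first.
    apply/esym/eqP; rewrite -subr_eq0 trS big_nat big1 // => j jm.
    by rewrite D0 ?linear0.
  have := esym trS; rewrite JS subrr big_nat => /eqP.
  rewrite psumr_eq0 => [|i im]; last exact/psd_mxtrace_ge0/(DP i im).1.
  move/allP => /(_ j); rewrite mem_index_iota ltnS jm => /(_ isT) /eqP.
  exact: psd_mxtrace_eq0 (DP j jm).1.
split=> //; apply: iff_trans trD _.
apply: iff_trans (iff_sym (algebraic_direct_sumP (B := fun j => A j.+1) _)); last first.
  by move=> j jm; apply: (hA j.+1 _).1.
apply: iff_trans (iff_sym (row_independentP (S := fun j => J j.+1) _ _)).
- split=> [D0 j jm|cap0 j jm].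
    have [_ DE] := DP j.+2 jm.
    by apply/eqP; rewrite -submx0 -DE D0.
  have [_ DE] := DP j jm; apply/eqP; rewrite -submx0 DE.
  by case: j jm {DE} => [|[|j]] // jm; rewrite cap0.
- by rewrite hJ1.
- move=> j jm.
  exact: (psd_join (hJ j.+1 (ltnW jm)) (hA j.+2 jm) (hJA j.+2 jm)).2.
Qed.

(** * Complex matrices *)

(** The real elements of [R[i]] are exactly the [t%:C], so the spectral order is
    the instance of [sle] at [R[i]]. *)
Section Bridge.
Variables (R : realType) (d : nat).
Local Open Scope complex_scope.
Implicit Types X Y Z : 'M[R[i]]_d.

Lemma spectral_leE X Y : spectral_le X Y <-> sle X Y.
Proof.
split=> [XY _ /complex_realP [t ->]|XY t]; first exact: XY.
by apply: XY; apply/complex_realP; exists t.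
Qed.

Lemma is_spectral_joinE X Y Z : is_spectral_join X Y Z <-> is_join X Y Z.
Proof.
split=> -[Zh /spectral_leE le1 /spectral_leE le2 Zm].
  split; [exact: Zh|exact: le1|exact: le2|move=> W Wh /spectral_leE W1 /spectral_leE W2].
  exact/spectral_leE/(Zm W Wh W1 W2).
split; [exact: Zh|exact: le1|exact: le2|move=> W Wh /spectral_leE W1 /spectral_leE W2].
exact/spectral_leE/(Zm W Wh W1 W2).
Qed.

Lemma is_spectral_meetE X Y Z : is_spectral_meet X Y Z <-> is_meet X Y Z.
Proof.
split=> -[Zh /spectral_leE le1 /spectral_leE le2 Zm].
  split; [exact: Zh|exact: le1|exact: le2|move=> W Wh /spectral_leE W1 /spectral_leE W2].
  exact/spectral_leE/(Zm W Wh W1 W2).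
split; [exact: Zh|exact: le1|exact: le2|move=> W Wh /spectral_leE W1 /spectral_leE W2].
exact/spectral_leE/(Zm W Wh W1 W2).
Qed.

Lemma spectral_joinP X Y : X \is hermsymmx -> Y \is hermsymmx ->
  is_join X Y (spectral_join X Y).
Proof.
move=> Xh Yh; have [Z ZJ _] := exists_join Xh Yh.
by apply/is_spectral_joinE; apply: (@xgetI _ 0 _ Z); apply/is_spectral_joinE.
Qed.

Lemma spectral_meetP X Y : X \is hermsymmx -> Y \is hermsymmx ->
  is_meet X Y (spectral_meet X Y).
Proof.
move=> Xh Yh; have [Z ZJ _] := exists_meet Xh Yh.
by apply/is_spectral_meetE; apply: (@xgetI _ 0 _ Z); apply/is_spectral_meetE.
Qed.

Lemma psd_spectral_join X Y : psd X -> psd Y -> psd (spectral_join X Y).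
Proof.
by move=> Xp Yp; have [] := psd_join Xp Yp (spectral_joinP Xp.1 Yp.1).
Qed.
End Bridge.

Local Open Scope complex_scope.

Theorem corollary2p4 (R : realType) (d m : nat) (hm : (2 <= m)%N)
    (A C D : nat -> 'M[R[i]]_d)
    (hA : forall j : nat, (1 <= j <= m)%N -> psdmx (A j))
    (hC1 : C 1%N = A 1%N)
    (hC : forall j : nat, (2 <= j <= m)%N ->
      C j = spectral_join (C j.-1) (A j))
    (hD : forall j : nat, (2 <= j <= m)%N ->
      D j = spectral_meet (C j.-1) (A j)) :
  let S := \sum_(1 <= j < m.+1) A j in
  [/\ \tr S - \tr (C m) = \sum_(2 <= j < m.+1) \tr (D j),
      \tr (C m) = \tr S <-> (forall j : nat, (2 <= j <= m)%N -> D j = 0)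
    & \tr (C m) = \tr S <->
      algebraic_direct_sum (fun j : 'I_m => mxran (A j.+1))].
Proof.
have Cp j : (1 <= j <= m)%N -> psd (C j).
  case: j => // k; elim: k => [|k IH] km; first by rewrite hC1; exact: hA.
  rewrite (hC k.+2 km).
  exact: psd_spectral_join (IH (ltnW km)) (hA k.+2 km).
have pm j : (2 <= j <= m)%N -> (1 <= j.-1 <= m)%N.
  by case: j => [|[|j]] // /ltnW.
have qm j : (2 <= j <= m)%N -> (1 <= j <= m)%N.
  by case: j => [|[|j]].
have Cj j (jm : (2 <= j <= m)%N) : is_join (C j.-1) (A j) (C j).
  rewrite (hC j jm).
  exact: spectral_joinP (Cp _ (pm j jm)).1 (hA _ (qm j jm)).1.
have Dj j (jm : (2 <= j <= m)%N) : is_meet (C j.-1) (A j) (D j).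
  rewrite (hD j jm).
  exact: spectral_meetP (Cp _ (pm j jm)).1 (hA _ (qm j jm)).1.
exact: (iterated_join (ltnW hm) hA Cp hC1 Cj Dj).
Qed.
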